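(* Let $G$ be a finite simple bipartite graph of order $n$ whose adjacency matrix $A(G)$ is non-singular, and suppose $G$ is not isomorphic to the path $P_4$. Then $\mathcal{E}(G)\geq n-1+\bar{d}$.
   Context: For a finite simple graph $G$ with $n$ vertices and $m$ edges, $A(G)$ is its adjacency matrix, $\lambda_1\ge\cdots\ge\lambda_n$ its eigenvalues, and the energy is $\mathcal{E}(G)=\sum_{i=1}^n|\lambda_i|$. $G$ is called non-singular if $A(G)$ is non-singular. $\bar d = 2m/n$ is the average degree. $P_4$ denotes the path on 4 vertices. *)

(* Defs.v *)
From HB Require Import structures.
From mathcomp Require Import all_boot all_order all_algebra all_field.
Set Implicit Arguments. Unset Strict Implicit. Unset Printing Implicit Defensive.
Import Order.TTheory GRing.Theory Num.Theory.
Local Open Scope ring_scope.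

Definition simple_graph (n : nat) (e : rel 'I_n) : Prop :=
  (forall i j, e i j = e j i) /\ (forall i, ~~ e i i).

Definition adj (n : nat) (e : rel 'I_n) : 'M[algC]_n :=
  \matrix_(i, j) (e i j)%:R.

Definition nedges (n : nat) (e : rel 'I_n) : nat :=
  #|[set p : 'I_n * 'I_n | e p.1 p.2 && (p.1 < p.2)%N]|.

Definition avg_degree (n : nat) (e : rel 'I_n) : algC :=
  (2 * nedges e)%:R / n%:R.

Definition eigenvalues_seq (n : nat) (A : 'M[algC]_n) (s : seq algC) : Prop :=
  char_poly A = \prod_(z <- s) ('X - z%:P).

Definition energy_of (s : seq algC) : algC := \sum_(z <- s) `|z|.

Definition bipartite (n : nat) (e : rel 'I_n) : Prop :=
  exists c : 'I_n -> bool, forall i j, e i j -> c i != c j.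

Definition graph_iso (n k : nat) (e : rel 'I_n) (e' : rel 'I_k) : Prop :=
  exists phi : 'I_n -> 'I_k, bijective phi /\ forall i j, e i j = e' (phi i) (phi j).

Definition P4 : rel 'I_4 := fun i j => ((i.+1 == j) || (j.+1 == i))%N.

(* Main.v *)
(* The two colour classes have the same size [k = n / 2], and the spectrum is
   symmetric, so that it consists of positive numbers [x_1, ..., x_k] and their
   opposites.  Here [sum x_i ^ 2 = m], [prod x_i >= 1] because the determinant
   is a nonzero integer, and [x_i <= k] because [k] bounds the degrees; we need
   [sum x_i >= k - 1 / 2 + m / (2 k)].  For [k >= 5], this follows from
   [prod x_i >= 1] by summing the bound
   [x - 1 - (x ^ 2 - 1) / (2 k) >= 4 (1 - 1 / k) (x ^ (1 / 4) - 1)],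
   valid on [0, k].  For [k = 3, 4], the graph is not complete bipartite, thus
   [m < k ^ 2], and a Newton inequality for the elementary symmetric function
   [e2] in [(sum x_i) ^ 2 = m + 2 e2] suffices.  The case [m <= k] is the AM-GM
   inequality, and the only other graph with [k <= 2] is the path P4. *)
Require Import Defs.
From HB Require Import structures.
From mathcomp Require Import all_boot all_order all_algebra all_fingroup all_field.
From mathcomp Require Import ring lra zify.
Set Implicit Arguments. Unset Strict Implicit. Unset Printing Implicit Defensive.
Import Order.TTheory GRing.Theory Num.Theory.
Local Open Scope ring_scope.

(** * Lower bounds on a sum, given its product and its sum of squares *)

Lemma size_le_sum (R : realFieldType) (r : seq R) :
  (forall x, x \in r -> 0 <= x) -> 1 <= \prod_(x <- r) x ->
  (size r)%:R <= \sum_(x <- r) x.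
Proof.
move=> r_ge0 r_prod; have [->|r_gt0] := posnP (size r).
  by rewrite big_seq; apply: sumr_ge0 => x /r_ge0.
have nth_ge0 (i : 'I_(size r)) : 0 <= r`_i by exact/r_ge0/mem_nth.
have [AGM _] := leif_AGM (A := 'I_(size r)) (fun i _ => nth_ge0 i).
have sumE : \sum_(x <- r) x = \sum_(i < size r) r`_i.
  by rewrite (big_nth 0) big_mkord.
have prodE : \prod_(x <- r) x = \prod_(i < size r) r`_i.
  by rewrite (big_nth 0) big_mkord.
rewrite card_ord -sumE -prodE in AGM.
have /(le_trans r_prod) := AGM.
rewrite expr_ge1 ?lt0n ?gt_eqF //; last first.
  by rewrite divr_ge0 ?ler0n // sumE sumr_ge0.
by rewrite ler_pdivlMr ?mul1r ?ltr0n.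
Qed.

(* The difference of the two sides is [(1 - y) ^+ 2] times
   [2 k (y ^+ 2 + 2 y + 3) -
     (y ^+ 6 + 2 y ^+ 5 + 3 y ^+ 4 + 4 y ^+ 3 + 5 y ^+ 2 + 6 y + 7)]. *)
Lemma tangent_bound (R : realFieldType) (k y : R) :
  5 <= k -> 0 <= y -> y ^+ 4 <= k ->
  8 * (k - 1) * (y - 1) <= 2 * k * (y ^+ 4 - 1) - (y ^+ 8 - 1).
Proof.
move=> k_ge5 y_ge0 y4_le.
have y2_ge0 : 0 <= y ^+ 2 + 2 * y + 3 by nra.
suff cof : 0 <= 2 * k * (y ^+ 2 + 2 * y + 3) -
    (y ^+ 6 + 2 * y ^+ 5 + 3 * y ^+ 4 + 4 * y ^+ 3 + 5 * y ^+ 2 + 6 * y + 7).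
  rewrite -subr_ge0; apply: le_trans (mulr_ge0 (sqr_ge0 (1 - y)) cof) _.
  by rewrite le_eqVlt; apply/orP; left; apply/eqP; ring.
(* From [5 <= k] and [y ^+ 4 <= k] come [2 k >= y ^+ 4 + 5], enough up to [3 / 2], and
   [2 k >= 2 y ^+ 4], enough beyond, where every coefficient in [z = y - 3 / 2] is positive. *)
have [y_le|y_ge] := leP y (3 / 2).
  have : 0 <= (2 * k - (y ^+ 4 + 5)) * (y ^+ 2 + 2 * y + 3).
    by apply: mulr_ge0 => //; lra.
  have : 0 <= 4 * (y + 2 - y ^+ 3) by nra.
  nra.
have : 0 <= (k - y ^+ 4) * (y ^+ 2 + 2 * y + 3).
  by apply: mulr_ge0 => //; lra.
pose z := y - 3 / 2.
have z_ge0 : 0 <= z by rewrite /z; lra.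
suff : 0 <= y ^+ 6 + 2 * y ^+ 5 + 3 * y ^+ 4
            - (4 * y ^+ 3 + 5 * y ^+ 2 + 6 * y + 7) by nra.
have -> : y = z + 3 / 2 by rewrite /z; lra.
have z2 := exprn_ge0 2 z_ge0; have z3 := exprn_ge0 3 z_ge0.
have z4 := exprn_ge0 4 z_ge0; have z5 := exprn_ge0 5 z_ge0.
have z6 := exprn_ge0 6 z_ge0.
lra.
Qed.

Lemma sum_ge_large (R : rcfType) (r : seq R) (k := (size r)%:R : R) :
  (4 < size r)%N -> (forall x, x \in r -> 0 <= x <= k) ->
  1 <= \prod_(x <- r) x ->
  k - 1 / 2 + (\sum_(x <- r) x ^+ 2) / (2 * k) <= \sum_(x <- r) x.
Proof.
move=> size_r r_bnd r_prod.
have k_ge5 : 5 <= k by rewrite ler_nat.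
pose root4 (x : R) := Num.sqrt (Num.sqrt x).
have root4K x : x \in r -> root4 x ^+ 4 = x.
  move=> /r_bnd/andP[x_ge0 _].
  by rewrite -[4%N]/(2 * 2)%N exprM !sqr_sqrtr ?sqrtr_ge0.
(* Fourth roots keep the product at least 1, so AM-GM applies to them too. *)
have root4_sum : k <= \sum_(x <- r) root4 x.
  have := @size_le_sum R [seq root4 x | x <- r].
  rewrite size_map !big_map; apply.
    by move=> y /mapP[x _ ->]; apply: sqrtr_ge0.
  rewrite -(@expr_ge1 _ 4) //; last first.
    by apply: prodr_ge0 => x _; apply: sqrtr_ge0.
  by rewrite -prodrXl big_seq (eq_bigr id) // -?big_seq.
have : \sum_(x <- r) (8 * (k - 1) * (root4 x - 1))
    <= \sum_(x <- r) (2 * k * (x - 1) - (x ^+ 2 - 1)).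
  rewrite !big_seq; apply: ler_sum => x xr.
  have /andP[_ x_le] := r_bnd _ xr.
  have := @tangent_bound _ k (root4 x) k_ge5 (sqrtr_ge0 _).
  by rewrite (exprM _ 4 2) root4K //; apply.
(* The [- 1] beside [x ^+ 2] adds up to [k], which becomes the [1 / 2] after division by [2 k]. *)
rewrite -mulr_sumr !sumrB -mulr_sumr !sumrB !big_const_seq !count_predT.
rewrite !iter_addr_0 -/k => ineq.
have : 0 <= 8 * (k - 1) * (\sum_(x <- r) root4 x - k).
  by apply: mulr_ge0; lra.
move: (\sum_(x <- r) x ^+ 2) (\sum_(x <- r) x) ineq => q s ineq pos.
have k_gt0 : 0 < 2 * k by lra.
rewrite -lerBrDl ler_pdivrMr //; lra.
Qed.

(* With three variables [e2 ^+ 2 >= 3 e1 e3], whence [e2 >= 3 w] where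
   [w ^+ 2 = e1 / 3]. *)
Lemma sum_ge_3 (R : rcfType) (a b c m : R) :
  0 <= a -> 0 <= b -> 0 <= c -> 1 <= a * b * c ->
  a ^+ 2 + b ^+ 2 + c ^+ 2 = m -> m <= 8 ->
  5 / 2 + m / 6 <= a + b + c.
Proof.
move=> a0 b0 c0 abc mE m_le.
have s_ge : 3 <= a + b + c.
  have := @size_le_sum R [:: a; b; c].
  rewrite !big_cons !big_nil addr0 mulr1 addrA mulrA; apply=> // x.
  by rewrite !inE => /or3P[] /eqP->.
pose w := Num.sqrt ((a + b + c) / 3).
have w_ge0 : 0 <= w by exact: sqrtr_ge0.
have sE : a + b + c = 3 * w ^+ 2 by rewrite sqr_sqrtr; lra.
have e2_ge : 3 * w <= a * b + b * c + c * a.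
  rewrite -(@ler_pXn2r _ 2) ?nnegrE //; [|nra|nra].
  have : 0 <= (a + b + c) * (a * b * c - 1) by apply: mulr_ge0; lra.
  have := sqr_ge0 (a * b - b * c); have := sqr_ge0 (b * c - c * a).
  have := sqr_ge0 (c * a - a * b); nra.
(* With [m <= 8] this gives [3 w ^+ 2 < 23 / 6], whence the bound on [w]. Eliminating [m] from
   [e1 ^+ 2 = m + 2 e2] leaves a quartic in [w] with root 1, whose cubic cofactor has constant sign
   up to that bound. *)
rewrite leNgt; apply/negP => s_lt.
have w_ge1 : 1 <= w by nra.
have w_lt : w < 1131 / 1000 by nra.
have : 9 * w ^+ 4 >= m + 6 * w.
  have -> : 9 * w ^+ 4 = (a + b + c) ^+ 2 by rewrite sE; ring.
  nra.
have : 0 <= (w - 1) * (5 + 3 * w - 3 * w ^+ 2 - 3 * w ^+ 3).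
  by apply: mulr_ge0; nra.
nra.
Qed.

(* The three perfect matchings of the four variables give
   [e2 ^+ 2 >= 3 (e1 e3 - 4 e4)], and [e1 e3 >= 16 e4]. *)
Lemma sum_ge_4 (R : rcfType) (a b c d m : R) :
  0 <= a -> 0 <= b -> 0 <= c -> 0 <= d -> 1 <= a * b * c * d ->
  a ^+ 2 + b ^+ 2 + c ^+ 2 + d ^+ 2 = m -> m <= 15 ->
  7 / 2 + m / 8 <= a + b + c + d.
Proof.
move=> a0 b0 c0 d0 abcd mE m_le.
have s_ge : 4 <= a + b + c + d.
  have := @size_le_sum R [:: a; b; c; d].
  rewrite !big_cons !big_nil addr0 mulr1 !addrA !mulrA; apply=> // x.
  by rewrite !inE => /or4P[] /eqP->.
pose e3 := a * b * c + a * b * d + a * c * d + b * c * d.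
have e3_ge : 4 <= e3.
  have := @size_le_sum R [:: a * b * c; a * b * d; a * c * d; b * c * d].
  rewrite !big_cons !big_nil addr0 mulr1 !addrA; apply=> // [x|].
    by rewrite !inE => /or4P[] /eqP->; rewrite !mulr_ge0.
  have -> : a * b * c * (a * b * d * (a * c * d * (b * c * d)))
    = (a * b * c * d) ^+ 3 by ring.
  by rewrite expr_ge1 // !mulr_ge0.
pose w := Num.sqrt ((a + b + c + d) / 4).
have w_ge0 : 0 <= w by exact: sqrtr_ge0.
have sE : a + b + c + d = 4 * w ^+ 2 by rewrite sqr_sqrtr; lra.
have e1e3 : 16 * (a * b * c * d) <= (a + b + c + d) * e3.
  have ab := mulr_ge0 a0 b0; have ac := mulr_ge0 a0 c0.
  have ad := mulr_ge0 a0 d0; have bc := mulr_ge0 b0 c0.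
  have bd := mulr_ge0 b0 d0; have cd := mulr_ge0 c0 d0.
  rewrite -subr_ge0.
  have -> : (a + b + c + d) * e3 - 16 * (a * b * c * d) =
     a * b * (c - d) ^+ 2 + a * c * (b - d) ^+ 2 + a * d * (b - c) ^+ 2 +
     b * c * (a - d) ^+ 2 + b * d * (a - c) ^+ 2 + c * d * (a - b) ^+ 2.
    by rewrite /e3; ring.
  by do !apply: addr_ge0; rewrite mulr_ge0 ?sqr_ge0.
(* Since [e4 <= e1 e3 / 16], the matchings give [e2 ^+ 2 >= (9 / 4) e1 e3], and [e3 >= 4] makes this
   at least [9 e1 = 36 w ^+ 2]. *)
have e2_ge : 6 * w <= a * b + a * c + a * d + b * c + b * d + c * d.
  rewrite -(@ler_pXn2r _ 2) ?nnegrE //; [|nra|by rewrite !addr_ge0 ?mulr_ge0].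
  have : 0 <= (a + b + c + d) * (e3 - 4) by apply: mulr_ge0; lra.
  have := sqr_ge0 ((a * b + c * d) - (a * c + b * d)).
  have := sqr_ge0 ((a * b + c * d) - (a * d + b * c)).
  have := sqr_ge0 ((a * c + b * d) - (a * d + b * c)).
  have -> : (6 * w) ^+ 2 = 9 * (a + b + c + d) by rewrite sE; ring.
  have := e1e3; rewrite /e3; lra.
rewrite leNgt; apply/negP => s_lt.
have w_ge1 : 1 <= w by nra.
(* Here [4 w ^+ 2 < 7 / 2 + 15 / 8]; the cubic cofactor below is still positive, though barely, at
   [116 / 100]. *)
have w_lt : w < 116 / 100 by nra.
have : 16 * w ^+ 4 >= m + 12 * w.
  have -> : 16 * w ^+ 4 = (a + b + c + d) ^+ 2 by rewrite sE; ring.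
  nra.
have : 0 <= (w - 1) * (7 + 4 * w - 4 * w ^+ 2 - 4 * w ^+ 3).
  by apply: mulr_ge0; nra.
nra.
Qed.

(** * Colour classes, degrees and edge counts *)

Definition degree (n : nat) (e : rel 'I_n) (i : 'I_n) : nat := #|[set j | e i j]|.

(** Some term of the Leibniz expansion is nonzero. For an adjacency matrix, [s] then moves every
    vertex to a neighbour. *)
Lemma det_neq0_perm (R : idomainType) (n : nat) (A : 'M[R]_n) :
  \det A != 0 -> exists s : 'S_n, forall i, A i (s i) != 0.
Proof.
move=> detA.
suff /existsP[s /forallP ?] : [exists s : 'S_n, forall i, A i (s i) != 0].
  by exists s.
apply: contraR detA; rewrite negb_exists => /forallP no_perm.
apply/eqP; apply: big1 => s _.
have := no_perm s; rewrite negb_forall => /existsP[i]; rewrite negbK => /eqP Ai.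
by rewrite (bigD1 i) //= Ai mul0r mulr0.
Qed.

(** A permutation along edges exchanges the two colours, so it maps each class bijectively onto the
    other. *)
Lemma bipartite_balanced (n : nat) (e : rel 'I_n) (c : 'I_n -> bool) (b : bool) :
  (forall i j, e i j -> c i != c j) -> \det (adj e) != 0 ->
  (#|[set i | c i == b]|.*2)%N = n.
Proof.
move=> bip /det_neq0_perm[s s_edge].
have flip i : c (s i) = ~~ c i.
  have : e i (s i) by have := s_edge i; rewrite mxE; case: (e i (s i)) => //; rewrite eqxx.
  by move=> /bip; case: (c i); case: (c _).
rewrite -addnn -{2}(card_imset _ (@perm_inj _ s)) -[RHS]card_ord -(cardsC [set i | c i == b]).
congr (_ + #|pred_of_set _|)%N; apply/setP => i; rewrite !inE; apply/imsetP/idP => [[j]|ci].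
  by rewrite inE => cj ->; rewrite flip; move: cj; case: (c j); case: b.
exists ((s^-1)%g i); last by rewrite permKV.
by rewrite inE; move: (flip ((s^-1)%g i)) ci; rewrite permKV => ->; case: (c _); case: b.
Qed.

Lemma sum_degree (n : nat) (e : rel 'I_n) :
  simple_graph e -> (\sum_i degree e i = 2 * nedges e)%N.
Proof.
move=> [sym irr].
pose E := [set p : 'I_n * 'I_n | e p.1 p.2].
pose up := [set p : 'I_n * 'I_n | (p.1 < p.2)%N].
have -> : (\sum_i degree e i = #|E|)%N.
  rewrite -sum1dep_card (eq_bigr (fun i => \sum_(j | e i j) 1)%N) => [|i _].
    by rewrite pair_big_dep /=.
  by rewrite /degree sum1dep_card.
rewrite -(cardsID up E) mul2n -addnn /nedges.
have -> : [set p : 'I_n * 'I_n | e p.1 p.2 && (p.1 < p.2)%N] = E :&: up.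
  by apply/setP => p; rewrite !inE.
congr (_ + _)%N.
have swapK : involutive (fun p : 'I_n * 'I_n => (p.2, p.1)) by case.
rewrite -(card_imset _ (inv_inj swapK)); apply: eq_card => p.
rewrite (can_imset_pre _ swapK) !inE /= sym.
by case: ssrnat.ltngtP => [||/val_inj/= ->]; rewrite ?andbT ?andbF ?(negPf (irr _)).
Qed.

Lemma bipartite_degree_le (n k : nat) (e : rel 'I_n) (c : 'I_n -> bool) :
  (forall i j, e i j -> c i != c j) -> (forall b, #|[set i | c i == b]| = k) ->
  forall i, (degree e i <= k)%N.
Proof.
move=> bip bal i; rewrite -(bal (~~ c i)); apply/subset_leq_card/subsetP => j.
by rewrite !inE => /bip; case: (c i); case: (c j).
Qed.

(* Otherwise the graph is complete bipartite and two rows of its adjacency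
   matrix are equal. *)
Lemma nonsingular_bipartite_nedges (n k : nat) (e : rel 'I_n) (c : 'I_n -> bool) :
  simple_graph e ->
  (forall i j, e i j -> c i != c j) -> (forall b, #|[set i | c i == b]| = k) ->
  n = k.*2 -> \det (adj e) != 0 -> (1 < k)%N -> (nedges e < k ^ 2)%N.
Proof.
move=> simple bip bal nk detA k_gt1.
have deg_le := bipartite_degree_le bip bal.
suff [i0 deg_lt] : exists i, (degree e i < k)%N.
  have := sum_degree simple; rewrite (bigD1 i0) //=.
  have : (\sum_(i | i != i0) degree e i <= \sum_(i : 'I_n | i != i0) k)%N.
    by apply: leq_sum.
  rewrite sum_nat_const cardC1 card_ord.
  move: (\sum_(i | _) _)%N => q; nia.
apply/existsP; apply: contraR detA; rewrite negb_exists => /forallP deg_ge.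
have nbr i : [set j | e i j] = [set j | c j == ~~ c i].
  apply/eqP; rewrite eqEcard bal leqNgt deg_ge andbT; apply/subsetP => j.
  by rewrite !inE => /bip; case: (c i); case: (c j).
have /card_gt1P[x [y [+ + xy]]] : (1 < #|[set i | c i == true]|)%N by rewrite bal.
rewrite !inE => /eqP cx /eqP cy.
apply/eqP/(determinant_alternate xy) => j; rewrite !mxE; congr (_%:R).
have /setP/(_ j) := nbr x; have /setP/(_ j) := nbr y.
by rewrite !inE cx cy => -> ->.
Qed.

(** The isomorphism sends a vertex to its position along the path; four distinct vertices exhaust
    ['I_4]. *)
Lemma isoP4 (e : rel 'I_4) (a x b y : 'I_4) :
  simple_graph e -> uniq [:: a; x; b; y] ->
  e a x -> e x b -> e b y -> ~~ e a y -> ~~ e a b -> ~~ e x y ->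
  graph_iso e P4.
Proof.
move=> [sym irr] uniq_p ax xb byE ay ab xy.
pose p := [:: a; x; b; y].
have mem_p i : i \in p.
  have [|_ ->] := uniq_min_size uniq_p (fun j _ => mem_enum 'I_4 j).
    by rewrite size_enum_ord.
  by rewrite mem_enum.
have idx_lt i : (index i p < 4)%N by rewrite (index_mem i p).
exists (fun i => Ordinal (idx_lt i)); split.
  apply: injF_bij => i j [] /(congr1 (nth a p)).
  by rewrite !nth_index.
move=> i j; rewrite /P4 /=.
move: (mem_p i) (mem_p j).
move: uniq_p; rewrite /= !inE !negb_or -!andbA andbT => /and5P[n1 n2 n3 n4 /andP[n5 n6]].
have neq := (negPf n1, negPf n2, negPf n3, negPf n4, negPf n5, negPf n6).
have edges := (ax, xb, byE, negPf ay, negPf ab, negPf xy).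
case/or4P => /eqP->; case/or4P => /eqP->; rewrite /= ?eqxx ?neq ?edges ?(negPf (irr _)) //.
all: by rewrite sym ?edges.
Qed.

Lemma bipartite_order4_isoP4 (e : rel 'I_4) (c : 'I_4 -> bool) :
  simple_graph e ->
  (forall i j, e i j -> c i != c j) -> (forall b, #|[set i | c i == b]| = 2%N) ->
  nedges e = 3%N -> graph_iso e P4.
Proof.
move=> simple bip bal m3; have [sym irr] := simple.
have /eqP/cards2P[a [b [ab setC]]] := bal true.
have /eqP/cards2P[x [y [xy setD]]] := bal false.
have cE i : c i = (i \in [set a; b]) by rewrite -setC inE eqb_id.
have ncE i : ~~ c i = (i \in [set x; y]) by rewrite -setD inE eqbF_neg.
have [ca cb] : c a /\ c b by rewrite !cE !inE !eqxx orbT.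
have [cx cy] : ~~ c x /\ ~~ c y by rewrite !ncE !inE !eqxx orbT.
have diff u v : c u -> ~~ c v -> u != v by move=> cu; apply: contraNneq => <-.
have [ax ay bx bY] : [/\ a != x, a != y, b != x & b != y] by split; apply: diff.
have same u v : c u = c v -> ~~ e u v by move=> uv; apply/negP => /bip; rewrite uv eqxx.
have nab : ~~ e a b by apply: same; rewrite ca cb.
have nxy : ~~ e x y by apply: same; rewrite (negPf cx) (negPf cy).
have sumE (F : 'I_4 -> nat) : (\sum_i F i = F a + F b + (F x + F y))%N.
  rewrite (bigID c) /=; congr (_ + _)%N.
    by rewrite (eq_bigl (mem [set a; b])) ?big_setU1 ?big_set1 ?inE //= => i; rewrite cE.
  by rewrite (eq_bigl (mem [set x; y])) ?big_setU1 ?big_set1 ?inE //= => i; rewrite ncE.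
have := sum_degree simple; rewrite m3.
have degE i : degree e i = (\sum_j e i j)%N.
  by rewrite /degree -sum1dep_card big_mkcond /=; apply: eq_bigr => j _; case: (e i j).
rewrite (eq_bigr _ (fun i _ => degE i)) !sumE.
rewrite !(negPf (irr _)) (sym b a) (sym y x) (negPf nab) (negPf nxy).
rewrite (sym x a) (sym x b) (sym y a) (sym y b).
(* The degree sum 6 leaves the four patterns with exactly one missing pair between the classes; that
   pair forms the two ends of the path. *)
case Eax: (e a x); case Eay: (e a y); case Ebx: (e b x); case Eby: (e b y) => //= _.
all: have neq := (ax, ay, bx, bY, ab, xy).
all: have neq' := (eq_sym b a, eq_sym x a, eq_sym y a, eq_sym x b, eq_sym y b, eq_sym y x).
- by apply: (@isoP4 e b x a y); rewrite //= ?inE ?negb_or ?neq' ?neq ?Eby // sym ?Eax.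
- by apply: (@isoP4 e b y a x); rewrite //= ?inE ?negb_or ?neq' ?neq ?Ebx // sym ?Eay.
- by apply: (@isoP4 e a x b y); rewrite //= ?inE ?negb_or ?neq' ?neq ?Eay // sym ?Ebx.
- by apply: (@isoP4 e a y b x); rewrite //= ?inE ?negb_or ?neq' ?neq ?Eax // sym ?Eby.
Qed.

(** * The spectrum of the adjacency matrix *)

Lemma char_poly_conj (F : fieldType) (n : nat) (P A : 'M[F]_n) :
  P \in unitmx -> char_poly (invmx P *m A *m P) = char_poly A.
Proof.
move=> P_unit; rewrite /char_poly.
have -> : char_poly_mx (invmx P *m A *m P) =
    map_mx polyC (invmx P) *m char_poly_mx A *m map_mx polyC P.
  rewrite /char_poly_mx mulmxBr mulmxBl -!map_mxM /=; congr (_ - _).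
  by rewrite scalar_mxC -mulmxA -map_mxM mulVmx //= map_mx1 mulmx1.
rewrite !det_mulmx mulrAC -det_mulmx -map_mxM mulVmx //.
by rewrite map_mx1 det1 mul1r.
Qed.

Lemma char_poly_diagonalized (F : fieldType) (n : nat) (P : 'M[F]_n) (d : 'rV_n) :
  P \in unitmx ->
  char_poly (invmx P *m diag_mx d *m P) = \prod_i ('X - (d 0 i)%:P).
Proof.
move=> P_unit; rewrite char_poly_conj // char_poly_trig ?diag_mx_is_trig //.
by apply: eq_bigr => i _; rewrite mxE eqxx.
Qed.

Lemma adj_hermitian (n : nat) (e : rel 'I_n) : simple_graph e -> adj e \is hermsymmx.
Proof.
move=> [sym _]; apply/is_hermitianmxP; rewrite expr0 scale1r.
by apply/matrixP => i j; rewrite !mxE sym conjC_nat.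
Qed.

(** The linear factors of a polynomial are unique up to order, so the spectral theorem for Hermitian
    matrices applies to any such [s]. *)
Lemma eigenvalues_perm_spectral (n : nat) (e : rel 'I_n) (s : seq algC) :
  simple_graph e -> eigenvalues_seq (adj e) s ->
  perm_eq s [seq spectral_diag (adj e) 0 i | i <- enum 'I_n].
Proof.
move=> simple es; apply: prod_XsubC_eq; rewrite -es big_map big_enum.
have /hermitian_normalmx/orthomx_spectralP {1}-> := adj_hermitian simple.
exact/char_poly_diagonalized/spectral_unit.
Qed.

Lemma eigenvalues_real (n : nat) (e : rel 'I_n) (s : seq algC) :
  simple_graph e -> eigenvalues_seq (adj e) s ->
  forall z, z \in s -> z \is Num.real.
Proof.
move=> simple es z; rewrite (perm_mem (eigenvalues_perm_spectral simple es)).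
move=> /mapP[i _ ->].
by have /mxOverP := hermitian_spectral_diag_real (adj_hermitian simple); apply.
Qed.

(** Both sides are the trace of the squared adjacency matrix, whose diagonal entries are the
    degrees. *)
Lemma sum_sqr_eigenvalues (n : nat) (e : rel 'I_n) (s : seq algC) :
  simple_graph e -> eigenvalues_seq (adj e) s ->
  \sum_(z <- s) z ^+ 2 = (\sum_i degree e i)%:R.
Proof.
move=> simple es; transitivity (\tr (adj e *m adj e)).
  rewrite (perm_big _ (eigenvalues_perm_spectral simple es)) /= big_map big_enum /=.
  have /hermitian_normalmx/orthomx_spectralP AE := adj_hermitian simple.
  move: (spectral_unit (adj e)) AE.
  move: (spectralmx _) (spectral_diag _) => P d P_unit ->.
  rewrite !mulmxA mulmxK // mxtrace_mulC !mulmxA mulmxV // mul1mx.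
  rewrite mulmx_diag mxtrace_diag; apply: eq_bigr => i _.
  by rewrite mxE expr2.
have [sym _] := simple.
rewrite natr_sum; apply: eq_bigr => i _; rewrite mxE /degree -sum1dep_card.
rewrite natr_sum [RHS]big_mkcond /=; apply: eq_bigr => j _.
by rewrite !mxE (sym j i); case: (e i j); rewrite ?mulr1 ?mulr0.
Qed.

(** The eigenvector equation is read at a coordinate of largest modulus. *)
Lemma eigenvalue_norm_le (n : nat) (e : rel 'I_n) (s : seq algC) (k : nat) :
  (forall i, degree e i <= k)%N -> simple_graph e -> eigenvalues_seq (adj e) s ->
  forall z, z \in s -> `|z| <= k%:R.
Proof.
move=> deg_le [sym _] es z; rewrite -root_prod_XsubC -es -eigenvalue_root_char.
move=> /eigenvalueP[v vA v_neq0].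
have [i0 vi0] : exists i, v 0 i != 0 by apply/rV0Pn.
have norm_real i : `|v 0 i| \is Num.real by exact: normr_real.
(* The order of [algC] is only partial, so the maximum is taken among real algebraic numbers. *)
have [i _ i_max] := @Order.TotalTheory.arg_maxP _ _ _ i0 xpredT
  (fun i => in_algR (norm_real i)) isT.
have {}i_max j : `|v 0 j| <= `|v 0 i| by exact: i_max.
have vi_gt0 : 0 < `|v 0 i|.
  by apply: lt_le_trans (i_max i0); rewrite normr_gt0.
rewrite -(ler_pM2r vi_gt0) -normrM.
have -> : z * v 0 i = \sum_j v 0 j * (e i j)%:R.
  have /rowP/(_ i) := vA; rewrite !mxE => <-; apply: eq_bigr => j _.
  by rewrite mxE sym.
apply: le_trans (ler_norm_sum _ _ _) _.
apply: (@le_trans _ _ (\sum_j `|v 0 i| * (e i j)%:R)).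
  by apply: ler_sum => j _; rewrite normrM normr_nat ler_wpM2r.
rewrite -mulr_sumr mulrC ler_wpM2r ?(ltW vi_gt0) // -natr_sum ler_nat.
apply: leq_trans (deg_le i); rewrite /degree -sum1dep_card [leqRHS]big_mkcond /=.
by apply: leq_sum => j _; case: (e i j).
Qed.

(** Up to sign the product is the determinant, a nonzero integer. *)
Lemma norm_prod_eigenvalues (n : nat) (e : rel 'I_n) (s : seq algC) :
  \det (adj e) != 0 -> eigenvalues_seq (adj e) s -> 1 <= `|\prod_(z <- s) z|.
Proof.
move=> detA es.
have det_int : \det (adj e) \in Num.int.
  rewrite (_ : adj e = map_mx intr (\matrix_(i, j) (e i j)%:R)) ?det_map_mx ?intr_int //.
  by apply/matrixP => i j; rewrite !mxE rmorph_nat.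
suff -> : `|\prod_(z <- s) z| = `|\det (adj e)| by apply: norm_intr_ge1.
have := char_poly_det (adj e); rewrite es coef0_prod_XsubC => /(congr1 Num.norm).
by rewrite !normrM !normrX normrN1 !expr1n !mul1r.
Qed.

(** Conjugation by the diagonal matrix [D] of colour signs negates every edge entry, so [adj e] is
    similar to its opposite. *)
Lemma eigenvalues_opp (n : nat) (e : rel 'I_n) (s : seq algC) :
  simple_graph e -> bipartite e -> eigenvalues_seq (adj e) s ->
  perm_eq s [seq - z | z <- s].
Proof.
move=> simple [c bip] es.
have sE := eigenvalues_perm_spectral simple es.
rewrite (perm_trans sE) // perm_sym (perm_trans (perm_map _ sE)) // perm_sym.
apply: prod_XsubC_eq; rewrite big_map big_enum [RHS]big_map [RHS]big_map big_enum /=.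
have /hermitian_normalmx/orthomx_spectralP AE := adj_hermitian simple.
have P_unit := spectral_unit (adj e).
rewrite -(char_poly_diagonalized _ P_unit) -AE.
pose D : 'rV[algC]_n := \row_i (-1) ^+ c i.
have DD : diag_mx D *m diag_mx D = 1%:M.
  rewrite mulmx_diag; apply/matrixP => i j; rewrite !mxE.
  by rewrite -expr2 sqrr_sign.
have D_unit : diag_mx D \in unitmx by case/mulmx1_unit: DD.
have invD : invmx (diag_mx D) = diag_mx D.
  by rewrite -[LHS]mulmx1 -DD mulKmx.
have negA : invmx (diag_mx D) *m adj e *m diag_mx D = - adj e.
  rewrite invD; apply/matrixP => i j; rewrite mul_diag_mx mul_mx_diag !mxE.
  case: (boolP (e i j)) => [/bip|_]; last by rewrite mulr0 mul0r oppr0.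
  by case: (c i); case: (c j) => //= _; rewrite ?expr0 ?expr1 ?mulr1 ?mul1r.
rewrite -(char_poly_conj (adj e) D_unit) negA.
transitivity (\prod_i ('X - ((- spectral_diag (adj e)) 0 i)%:P)); last first.
  by apply: eq_bigr => i _; rewrite mxE.
by rewrite -(char_poly_diagonalized _ P_unit) raddfN /= mulmxN mulNmx -AE.
Qed.

(** * Case analysis on size and edge count, and assembly *)

Lemma sum_ge (R : rcfType) (r : seq R) (m : nat) (k := (size r)%:R : R) :
  (forall x, x \in r -> 0 <= x <= k) -> 1 <= \prod_(x <- r) x ->
  \sum_(x <- r) x ^+ 2 = m%:R ->
  (m <= size r)%N || (2 < size r)%N && (m < size r ^ 2)%N ->
  k - 1 / 2 + m%:R / (2 * k) <= \sum_(x <- r) x.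
Proof.
move=> r_bnd r_prod sum_sqr.
have r_ge0 x : x \in r -> 0 <= x by move=> /r_bnd/andP[].
case/orP => [m_le|/andP[k_gt2 m_lt]].
  apply: le_trans (size_le_sum r_ge0 r_prod); rewrite -/k.
  suff : m%:R / (2 * k) <= 1 / 2 by lra.
  (* For an empty list the quotient by [2 k] is 0 by convention. *)
  have [k0|k_gt0] := posnP (size r); first by rewrite /k k0 mulr0 invr0 mulr0; lra.
  have k_pos : 0 < k by rewrite ltr0n.
  have m_lek : m%:R <= k by rewrite ler_nat.
  rewrite ler_pdivrMr; lra.
have [k_gt4|k_le4] := ltnP 4 (size r).
  by rewrite -sum_sqr; apply: sum_ge_large.
have [k3|k4] : size r = 3%N \/ size r = 4%N by lia.
  move: r_ge0 r_prod sum_sqr m_lt; rewrite /k k3 => {r_bnd k_gt2 k_le4 k}.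
  case: r k3 => [|a [|b [|c []]]] //= _; rewrite !big_cons !big_nil.
  rewrite !addr0 mulr1 !addrA !mulrA => r_ge0 r_prod sum_sqr m_lt.
  have m_le : m%:R <= 8 :> R by rewrite ler_nat.
  have := @sum_ge_3 R a b c m%:R; rewrite !r_ge0 ?inE ?eqxx ?orbT //.
  by move=> /(_ isT isT isT r_prod sum_sqr m_le); lra.
move: r_ge0 r_prod sum_sqr m_lt; rewrite /k k4 => {r_bnd k_gt2 k_le4 k}.
case: r k4 => [|a [|b [|c [|d []]]]] //= _; rewrite !big_cons !big_nil.
rewrite !addr0 mulr1 !addrA !mulrA => r_ge0 r_prod sum_sqr m_lt.
have m_le : m%:R <= 15 :> R by rewrite ler_nat.
have := @sum_ge_4 R a b c d m%:R; rewrite !r_ge0 ?inE ?eqxx ?orbT //.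
by move=> /(_ isT isT isT isT r_prod sum_sqr m_le); lra.
Qed.

(** The symmetry under negation matches the negative elements, with multiplicity, to the opposites
    of the positive ones. *)
Lemma perm_positive_half (R : numDomainType) (s : seq R) :
  (forall z, z \in s -> z \is Num.real) -> 0 \notin s ->
  perm_eq s [seq - z | z <- s] ->
  perm_eq s ([seq z <- s | 0 < z] ++ [seq - z | z <- s & 0 < z]).
Proof.
move=> s_real s_neq0 s_opp.
rewrite -(perm_filterC [pred z | 0 < z] s) perm_cat2l.
have -> : [seq z <- s | predC [pred z | 0 < z] z] = [seq z <- s | z < 0].
  apply: eq_in_filter => z zs /=; have z_real := s_real z zs.
  have : z != 0 by apply: contraNneq s_neq0 => <-.
  by rewrite real_neqr_lt ?real0 // => /orP[] z_lt; rewrite z_lt lt_gtF.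
rewrite (perm_trans (perm_filter _ s_opp)) // filter_map.
by rewrite (eq_filter (a2 := fun z => 0 < z)) // => z; rewrite /= oppr_lt0.
Qed.

(** Only [k = 2] with three edges escapes both alternatives, and that graph is the path. *)
Lemma nedges_le_or_lt (n k : nat) (e : rel 'I_n) (c : 'I_n -> bool) :
  simple_graph e ->
  (forall i j, e i j -> c i != c j) -> (forall b, #|[set i | c i == b]| = k) ->
  n = k.*2 -> \det (adj e) != 0 -> ~ graph_iso e P4 ->
  (nedges e <= k)%N || (2 < k)%N && (nedges e < k ^ 2)%N.
Proof.
move=> simple bip bal nk detA not_P4.
have m_le : (nedges e <= k * k)%N.
  have := sum_degree simple.
  have : (\sum_i degree e i <= \sum_(i : 'I_n) k)%N.
    by apply: leq_sum => i _; apply: bipartite_degree_le bal i.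
  rewrite sum_nat_const card_ord; move: (\sum_i _)%N => q; nia.
have [k_le1|k_gt1] := leqP k 1; first by rewrite (leq_trans m_le) //; nia.
have m_lt := nonsingular_bipartite_nedges simple bip bal nk detA k_gt1.
rewrite m_lt andbT; have [_|k_le2] := ltnP 2 k; first by rewrite orbT.
have k2 : k = 2%N by lia.
rewrite orbF k2; have [//|m_gt2] := leqP (nedges e) 2.
have m3 : nedges e = 3%N by move: m_lt; rewrite k2; lia.
by subst k n; case: not_P4; apply: bipartite_order4_isoP4 simple bip bal m3.
Qed.

Theorem theorem2p2 (n : nat) (e : rel 'I_n) (s : seq algC) :
  simple_graph e -> bipartite e ->
  \det (adj e) != 0 ->
  ~ graph_iso e P4 ->
  eigenvalues_seq (adj e) s ->
  n%:R - 1 + avg_degree e <= energy_of s.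
Proof.
move=> simple bip detA not_P4 es; have [c c_bip] := bip.
have [k bal] : exists k, forall b, #|[set i | c i == b]| = k.
  by exists n./2 => b; rewrite -[LHS]doubleK (bipartite_balanced b c_bip detA).
have nk : n = k.*2 by rewrite -(bal true) (bipartite_balanced true c_bip detA).
have prod_ge1 := norm_prod_eigenvalues detA es.
have s_real := eigenvalues_real simple es.
have s_neq0 : 0 \notin s.
  apply/negP => s0; move: prod_ge1.
  by rewrite (big_rem _ s0) /= mul0r normr0 ler10.
have := perm_positive_half s_real s_neq0 (eigenvalues_opp simple bip es).
set r0 := [seq z <- s | 0 < z] => s_perm.
have r0_gt0 z : z \in r0 -> 0 < z by rewrite mem_filter => /andP[].
(* The positive eigenvalues are moved to the real closed field of real algebraic numbers, where
   [sum_ge] applies. All are real, so the default 0 of [insubd] never occurs. *)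
have [r rE] : exists r, map algRval r = r0.
  exists [seq insubd 0 z | z <- r0]; rewrite -map_comp map_id_in // => z zr.
  by move: zr; rewrite mem_filter => /andP[_ /s_real zr]; rewrite /= insubdK.
have sum_s (F : algC -> algC) : \sum_(z <- s) F z =
    \sum_(x <- r) (F (algRval x) + F (- algRval x)).
  by rewrite (perm_big _ s_perm) big_cat /= !big_map -rE !big_map -big_split.
have size_r : size r = k.
  have : size s = n by have := size_char_poly (adj e); rewrite es size_prod_XsubC => -[].
  by rewrite (perm_size s_perm) size_cat size_map -rE size_map nk addnn => /double_inj.
have r_gt0 x : x \in r -> 0 < x.
  by move=> xr; apply: (r0_gt0 (algRval x)); rewrite -rE map_f.
have r_bnd x : x \in r -> 0 <= x <= (size r)%:R.
  move=> xr; rewrite ltW ?r_gt0 //=.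
  have deg_le := bipartite_degree_le c_bip bal.
  have := eigenvalue_norm_le deg_le simple es.
  move=> /(_ (algRval x)); rewrite (perm_mem s_perm) mem_cat -rE map_f //.
  move=> /(_ isT); rewrite ger0_norm; last exact/ltW/(r_gt0 x xr).
  by rewrite size_r -(rmorph_nat algRval).
have r_prod : 1 <= \prod_(x <- r) x.
  have prod_ge0 : 0 <= \prod_(x <- r) x.
    by rewrite big_seq prodr_ge0 // => x /r_gt0/ltW.
  (* Each [x] in [r] accounts for the eigenvalues [x] and [- x], so the norm of the full product is
     the square of this one. *)
  rewrite -(@expr_ge1 _ 2) //.
  move: prod_ge1; rewrite (perm_big _ s_perm) big_cat /= !big_map -rE !big_map.
  rewrite normrM !normr_prod.
  under [X in _ * X]eq_bigr do rewrite normrN.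
  rewrite -expr2 -normr_prod.
  by rewrite -(rmorph_prod algRval) real_normK ?(valP (\prod_(x <- r) x)) // -rmorphXn.
have sum_sqr : \sum_(x <- r) x ^+ 2 = (nedges e)%:R.
  apply: (fmorph_inj algRval).
  have := sum_sqr_eigenvalues simple es.
  rewrite sum_degree // sum_s natrM.
  under eq_bigr => x _ do rewrite sqrrN -mulr2n -mulr_natl.
  have two_neq0 : 2%:R != 0 :> algC by rewrite pnatr_eq0.
  rewrite -mulr_sumr rmorph_sum rmorph_nat => /(mulfI two_neq0) <-.
  by apply: eq_bigr => x _; rewrite rmorphXn.
have m_cond := nedges_le_or_lt simple c_bip bal nk detA not_P4.
rewrite -size_r in m_cond.
have := sum_ge r_bnd r_prod sum_sqr m_cond.
rewrite size_r => ineq.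
have -> : energy_of s = algRval (2 * \sum_(x <- r) x).
  rewrite /energy_of sum_s rmorphM rmorph_sum mulr_sumr rmorph_nat.
  rewrite !big_seq; apply: eq_bigr => x /r_gt0 x_gt0.
  by rewrite normrN ger0_norm ?mulr_natl ?mulr2n //; apply/ltW.
(* Twice the bound for the positive half is [2 k - 1 + m / k], with [n = 2 k]. *)
have -> : n%:R - 1 + avg_degree e =
  algRval (2 * (k%:R - 1 / 2 + (nedges e)%:R / (2 * k%:R))).
  rewrite !(rmorphM algRval, rmorphD algRval, rmorphN algRval, fmorphV algRval,
            rmorph_nat algRval, rmorph1 algRval).
  rewrite -[1 + 1]/(2 : algC) /avg_degree; have -> : n%:R = 2 * k%:R :> algC.
    by rewrite [in LHS]nk -mul2n natrM.
  (* Abstracting the inverse avoids a side condition, so [k = 0] is covered. *)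
  by rewrite natrM; move: (2 * k%:R)^-1 => v; field.
have double_ineq : 2 * (k%:R - 1 / 2 + (nedges e)%:R / (2 * k%:R)) <= 2 * \sum_(x <- r) x by lra.
exact: double_ineq.
Qed.
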